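(* Let $\|\cdot\|$ be a norm on $\mathbb R^d$ with dual norm $\|\cdot\|_\ast$. Assume that, almost surely, $f_\xi$ is convex and $L$-smooth with respect to $\|\cdot\|$ ($L>0$). Assume further that $f$ is $\mu$-strongly convex relative to $\psi$ on $\mathcal X$ ($\mu>0$), that $\psi$ is $\mu_\psi$-strongly convex over $\mathcal X$ with respect to $\|\cdot\|$ ($\mu_\psi>0$), and that $\psi$ satisfies the interior condition stated in the context. Let $c\ge\frac12$, $\eta_b>0$, and let $(x_t)_{t\ge1}$ be the iterates of stochastic mirror descent with the stepsizes $$\eta_t=\min\left\{\frac{\mu_\psi\,(f_{\xi_t}(x_t)-f_{\xi_t}^\ast)}{c\,\|\nabla f_{\xi_t}(x_t)\|_\ast^2},\ \eta_b\right\}.$$ Then for every $x_\ast\in\mathcal X_\ast$ and every $t\ge1$, $$\mathbb E\left[B_\psi(x_\ast;x_{t+1})\right]\le(1-\mu\alpha)^tB_\psi(x_\ast;x_1)+\frac{\eta_b\sigma^2}{\alpha\mu},\qquad\text{where }\alpha=\min\left\{\frac{\mu_\psi}{2cL},\eta_b\right\}.$$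
   Context: Setting. $\mathcal X\subseteq\mathbb R^d$ is a nonempty closed convex set (possibly unbounded), $\psi:\mathcal D\to\mathbb R$ is a convex function, differentiable on $\operatorname{int}\mathcal D$, with $\mathcal X\subseteq\mathcal D\subseteq\mathbb R^d$. $\xi$ is a random vector supported on a set $\Xi$; $f_\xi:\mathbb R^d\to\mathbb R$ is differentiable, $f(x)=\mathbb E_\xi[f_\xi(x)]$ is well defined and differentiable, and $\mathbb E_\xi[\nabla f_\xi(x)]=\nabla f(x)$ for each $x\in\mathcal X$; all expectations involved are assumed well defined. $\mathcal X_\ast$ is the set of minimizers of $f$ over $\mathcal X$, assumed nonempty. Bregman divergence: $B_h(x;y)=h(x)-h(y)-\langle\nabla h(y),x-y\rangle$. A function $h$ is $L$-smooth with respect to $\|\cdot\|$ if $B_h(x;y)\le\frac L2\|x-y\|^2$ for all $x,y\in\mathbb R^d$. $\psi$ is $\mu_\psi$-strongly convex over $\mathcal X$ with respect to $\|\cdot\|$ if $\frac{\mu_\psi}2\|x-y\|^2\le B_\psi(x;y)$ for all $(x,y)\in\mathcal X\times(\mathcal X\cap\operatorname{int}\mathcal D)$. $f$ is $\mu$-strongly convex relative to $\psi$ on $\mathcal X$ if $\mu B_\psi(x;y)\le B_f(x;y)$ for all $(x,y)\in\mathcal X\times(\mathcal X\cap\operatorname{int}\mathcal D)$. The dual norm is $\|x\|_\ast=\sup\{\langle x,y\rangle:\|y\|\le1\}$. Interior condition on $\psi$: for every $x_t\in\mathcal X\cap\operatorname{int}\mathcal D$, every vector $g$ and every stepsize $\eta_t>0$,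 the point $x_{t+1}=\arg\min_{x\in\mathcal X}\{\langle g,x\rangle+\frac1{\eta_t}B_\psi(x;x_t)\}$ exists and lies in $\operatorname{int}\mathcal D$. Stochastic mirror descent: $x_1\in\mathcal X\cap\operatorname{int}\mathcal D$ is deterministic, $\xi_1,\xi_2,\dots$ are i.i.d. copies of $\xi$, and $x_{t+1}=\arg\min_{x\in\mathcal X}\{\langle\nabla f_{\xi_t}(x_t),x\rangle+\frac1{\eta_t}B_\psi(x;x_t)\}$. Convention: if $\nabla f_{\xi_t}(x_t)=0$, take $\eta_t=\eta_b$ (the update then gives $x_{t+1}=x_t$). $f_\xi^\ast=\inf_{x\in\mathbb R^d}f_\xi(x)$, and $\sigma^2=f(x_\ast)-\mathbb E_\xi[f_\xi^\ast]$ for $x_\ast\in\mathcal X_\ast$, assumed $<\infty$. *)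

(* Defs.v *)
From HB Require Import structures.
From mathcomp Require Import all_boot all_order all_algebra.
From mathcomp Require Import all_classical all_reals all_analysis.

Set Implicit Arguments.
Unset Strict Implicit.
Unset Printing Implicit Defensive.

Import Order.TTheory GRing.Theory Num.Theory.
Import numFieldNormedType.Exports.

Local Open Scope classical_set_scope.
Local Open Scope ring_scope.

(* R^d is 'rV[R]_d with its library (sup-norm) topology, which is the usual one;
   the norm with respect to which smoothness and strong convexity are measured
   is a separate, arbitrary function N. *)

Section Geometry.
Context {R : realType} {d : nat}.
Implicit Types (x y z g u v : 'rV[R]_d) (h f psi : 'rV[R]_d -> R)
  (N : 'rV[R]_d -> R) (X D : set 'rV[R]_d).

Definition dot u v : R := \sum_(i < d) u 0 i * v 0 i.

(* Nonnegativity of N follows from these axioms. *)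
Record is_norm N : Prop := IsNorm {
  norm_triangle : forall x y, N (x + y) <= N x + N y;
  norm_scale : forall (a : R) x, N (a *: x) = `|a| * N x;
  norm_separated : forall x, N x = 0 -> x = 0 }.

Definition dual_norm N x : R := sup [set dot x y | y in [set y | N y <= 1]].

(* Vector of partial derivatives; meaningful where h is differentiable. *)
Definition gradient h x : 'rV[R]_d := \row_(i < d) 'D_(delta_mx 0 i) h x.

Definition bregman h x y : R := h x - h y - dot (gradient h y) (x - y).

Definition smooth N (L : R) h : Prop :=
  forall x y, bregman h x y <= L / 2 * N (x - y) ^+ 2.

Definition strongly_convex N (mu : R) X D psi : Prop :=
  forall x y, X x -> X y -> D° y -> mu / 2 * N (x - y) ^+ 2 <= bregman psi x y.

Definition relatively_strongly_convex (mu : R) X D psi f : Prop :=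
  forall x y, X x -> X y -> D° y -> mu * bregman psi x y <= bregman f x y.

Definition is_argmin X h z : Prop := X z /\ forall y, X y -> h z <= h y.

Definition minimizers X f : set 'rV[R]_d := [set z | is_argmin X f z].

(* z is the mirror step from y along g with stepsize eta. Uniqueness of the
   minimizer is not part of the definition; it follows from strong convexity
   of psi together with the interior condition. *)
Definition mirror_step psi X g (eta : R) y z : Prop :=
  is_argmin X (fun u => dot g u + eta^-1 * bregman psi u y) z.

Definition interior_condition psi X D : Prop :=
  forall y g (eta : R), X y -> D° y -> 0 < eta ->
    exists z, mirror_step psi X g eta y z /\ D° z.

(* Infimum over the whole space, possibly -oo. *)
Definition infimum h : \bar R := ereal_inf [set (h x)%:E | x in setT].

(* The extended-real minimum is always finite, since h x - inf h >= 0 and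
   eta_b is real; if inf h = -oo, it is eta_b. The first branch is the
   convention for a vanishing gradient. *)
Definition polyak_step N (mu_psi c eta_b : R) h x : R :=
  if gradient h x == 0 then eta_b
  else fine (Order.min
    (mu_psi%:E * ((h x)%:E - infimum h)
       / (c * dual_norm N (gradient h x) ^+ 2)%:E)%E
    eta_b%:E).

End Geometry.

Section Stochastic.
Context {R : realType} {dO dS : measure_display}
  {Omega : measurableType dO} {Xi : measurableType dS}.

Definition mutually_independent (P : probability Omega R)
    (xi : nat -> Omega -> Xi) : Prop :=
  forall (J : seq nat) (A : nat -> set Xi),
    uniq J -> (forall j, measurable (A j)) ->
    P (\bigcap_(j in [set` J]) (xi j @^-1` A j))
    = (\prod_(j <- J) P (xi j @^-1` A j))%E.

Definition iid (P : probability Omega R) (law : probability Xi R)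
    (xi : nat -> {RV P >-> Xi}) : Prop :=
  (forall n A, measurable A -> distribution P (xi n) A = law A) /\
  mutually_independent P (fun n => xi n).

(* sigma^2; extended-real because E[inf f_xi] may be -oo. *)
Definition noise {d : nat} (law : probability Xi R) (F : Xi -> 'rV[R]_d -> R)
    (f : 'rV[R]_d -> R) (xstar : 'rV[R]_d) : \bar R :=
  ((f xstar)%:E - \int[law]_s infimum (F s))%E.

End Stochastic.

(* Main.v *)
(* For a sample h = F s with inf h finite, the three-point inequality for the
   mirror step, convexity of h, and the stepsize bound
   eta |grad h(y)|_*^2 <= 2 mu_psi (h y - inf h) give
     B_psi(x*; y') <= B_psi(x*; y) - eta B_h(x*; y) + eta (h x* - inf h).
   Smoothness yields |grad h(y)|_*^2 <= 2 L (h y - inf h), hence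
   alpha <= eta <= eta_b; as B_h and h x* - inf h are nonnegative, eta can be
   replaced by alpha in front of the former and by eta_b in front of the latter.
   Averaging over s turns B_h into B_f >= mu B_psi, which gives the recursion
   E_{t+1} <= (1 - mu alpha) E_t + eta_b sigma^2.

   Averaging requires the iterates to be random vectors: the next iterate is
   Q(grad psi(y) - eta grad h(y)), where Q(v), the minimiser of psi - <v, .>
   over X, is Lipschitz in v by strong convexity, so x_t is measurable with
   respect to the sigma-algebra generated by xi_0, ..., xi_{t-1}, which is
   independent of xi_t. *)
Require Import Defs.
From HB Require Import structures.
From mathcomp Require Import all_boot all_order all_algebra.
From mathcomp Require Import all_classical all_reals all_analysis.
From mathcomp Require Import measurable_realfun.
From mathcomp Require Import ring lra.
Set Implicit Arguments.
Unset Strict Implicit.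
Unset Printing Implicit Defensive.

Import Order.TTheory GRing.Theory Num.Theory.
Import numFieldNormedType.Exports.
Local Open Scope classical_set_scope.
Local Open Scope ring_scope.

(** * First-order conditions *)

Section dot_product.
Context {R : realType} {d : nat}.
Implicit Types (u v w : 'rV[R]_d) (a : R).

Lemma dotDr u v w : dot u (v + w) = dot u v + dot u w.
Proof. by rewrite /dot -big_split/=; apply: eq_bigr => i _; rewrite mxE mulrDr. Qed.

Lemma dotDl u v w : dot (u + v) w = dot u w + dot v w.
Proof. by rewrite /dot -big_split/=; apply: eq_bigr => i _; rewrite mxE mulrDl. Qed.

Lemma dotZr a u v : dot u (a *: v) = a * dot u v.
Proof. by rewrite /dot mulr_sumr; apply: eq_bigr => i _; rewrite mxE mulrCA. Qed.

Lemma dotZl a u v : dot (a *: u) v = a * dot u v.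
Proof. by rewrite /dot mulr_sumr; apply: eq_bigr => i _; rewrite mxE mulrA. Qed.

Lemma dotNr u v : dot u (- v) = - dot u v.
Proof. by rewrite -scaleN1r dotZr mulN1r. Qed.

Lemma dotNl u v : dot (- u) v = - dot u v.
Proof. by rewrite -scaleN1r dotZl mulN1r. Qed.

Lemma dotBr u v w : dot u (v - w) = dot u v - dot u w.
Proof. by rewrite dotDr dotNr. Qed.

Lemma dotBl u v w : dot (u - v) w = dot u w - dot v w.
Proof. by rewrite dotDl dotNl. Qed.

Lemma dot0r u : dot u 0 = 0.
Proof. by rewrite /dot big1// => i _; rewrite mxE mulr0. Qed.

Lemma dot0l u : dot 0 u = 0.
Proof. by rewrite /dot big1// => i _; rewrite mxE mul0r. Qed.

Lemma dot_self_eq0 u : dot u u = 0 -> u = 0.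
Proof.
move=> /eqP; rewrite psumr_eq0 => [/allP u0|i _]; last by rewrite -expr2 sqr_ge0.
apply/rowP => i; rewrite mxE; apply/eqP.
by have := u0 i (mem_index_enum _); rewrite mulf_eq0 orbb.
Qed.

Lemma dot_le_norm u v : `|dot u v| <= d%:R * `|u| * `|v|.
Proof.
rewrite (le_trans (ler_norm_sum _ _ _))//.
have -> : d%:R * `|u| * `|v| = \sum_(i < d) `|u| * `|v|.
  by rewrite sumr_const card_ord -mulrA mulr_natl.
have le_coord (w : 'rV[R]_d) i : `|w 0 i| <= `|w|.
  rewrite [`|w|]mx_normrE.
  exact: (@le_bigmax _ _ _ 0 (fun ij => `|w ij.1 ij.2|) (0, i)).
by apply: ler_sum => i _; rewrite normrM ler_pM.
Qed.

End dot_product.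

Section gradient.
Context {R : realType} {d : nat}.
Implicit Types (y v z : 'rV[R]_d) (h : 'rV[R]_d -> R).

Lemma derive_gradient h y v :
  differentiable h y -> 'D_v h y = dot (gradient h y) v.
Proof.
move=> dh; rewrite deriveE// {1}(row_sum_delta v) linear_sum /dot.
by apply: eq_bigr => i _; rewrite linearZ mxE deriveE// mulrC.
Qed.

(** The sequential form of the directional derivative serves twice: inequalities pass to the limit,
    and partial derivatives become limits of measurable functions. *)
Lemma gradient_cvg h y v : differentiable h y ->
  (n.+1%:R * (h (y + n.+1%:R^-1 *: v) - h y)) @[n --> \oo]
    --> dot (gradient h y) v.
Proof.
move=> dh; rewrite -derive_gradient//.
have /cvg_ex[l hl] := @diff_derivable _ _ _ _ _ v dh.
have -> : 'D_v h y = l; first exact: (cvg_lim _ hl).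
have u0 n : @harmonic R n != 0 by rewrite gt_eqF ?harmonic_gt0.
have := (cvgr_dnbhsP (fun t => t^-1 *: ((h \o shift y) (t *: v) - h y)) 0 l).1
  hl harmonic (conj u0 cvg_harmonic).
apply: cvg_trans; apply: near_eq_cvg; apply: nearW => n.
by rewrite /= /shift /= invrK [_ *: v + y]addrC.
Qed.

(** Only steps [0 < t <= 1] are tested, those for which convexity controls [y + t *: v]. *)
Lemma gradient_ge h y v k : differentiable h y ->
  (forall t, 0 < t <= 1 -> t * k <= h (y + t *: v) - h y) ->
  k <= dot (gradient h y) v.
Proof.
move=> dh hk; have hc := gradient_cvg (v := v) dh.
rewrite -(cvg_lim _ hc)//; apply: limr_ge; first by apply/cvg_ex; eexists; exact: hc.
apply: nearW => n; rewrite -ler_pdivrMl// hk// invr_gt0 ltr0n/=.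
by rewrite invf_le1// ler1n.
Qed.

Lemma gradient_le h y v k : differentiable h y ->
  (forall t, 0 < t <= 1 -> h (y + t *: v) - h y <= t * k) ->
  dot (gradient h y) v <= k.
Proof.
move=> dh hk; have hc := gradient_cvg (v := v) dh.
rewrite -(cvg_lim _ hc)//; apply: limr_le; first by apply/cvg_ex; eexists; exact: hc.
apply: nearW => n; rewrite -ler_pdivlMl// hk// invr_gt0 ltr0n/=.
by rewrite invf_le1// ler1n.
Qed.

(** Convexity on the segment from [y] to [x] bounds each difference quotient by [h x - h y]. *)
Lemma convex_bregman_ge0 h x y : convex_function setT h ->
  differentiable h y -> 0 <= bregman h x y.
Proof.
move=> ch dh; rewrite /bregman subr_ge0; apply: gradient_le => // t /andP[t0 t1].
have := ch (Itv01 (ltW t0) t1) x y (in_setT _) (in_setT _).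
rewrite convRE/= /conv/= /unstable.onem => hxy.
suff -> : y + t *: (x - y) = t *: x + (1 - t) *: y by lra.
by rewrite scalerBr scalerBl scale1r addrCA.
Qed.

(** Moving from [z] towards [u] stays in [X] and cannot decrease the tilted objective, so its
    directional derivative at [z] is nonnegative. *)
Lemma argmin_gradient X h v z u : convex_set X ->
  is_argmin X (fun w => h w - dot v w) z -> differentiable h z -> X u ->
  0 <= dot (gradient h z - v) (u - z).
Proof.
move=> cX [Xz zmin] dh Xu; rewrite dotBl subr_ge0.
apply: gradient_ge => // t /andP[t0 t1].
have := cX u z (Itv01 (ltW t0) t1); rewrite !inE => /(_ Xu Xz).
rewrite /conv/= /unstable.onem.
have -> : t *: u + (1 - t) *: z = z + t *: (u - z).
  by rewrite scalerBr scalerBl scale1r addrCA.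
by move=> /zmin; rewrite dotDr dotZr; lra.
Qed.

End gradient.

(** * Norms and dual norms *)

Lemma lipschitz_cts (R : realType) (V : normedModType R) (K : R) (h : V -> R) :
  (forall x y, h x - h y <= K * `|x - y|) -> continuous h.
Proof.
move=> hK x; apply/cvgrPdist_le => e e0.
(* The sign of [K] is free, so [|K| + 1] serves as a positive divisor. *)
have K0 : 0 < `|K| + 1 by rewrite ltr_wpDl.
near=> y; have xy : `|x - y| <= e / (`|K| + 1).
  by near: y; apply: cvgr_dist_le => //; exact: divr_gt0.
have Kxy : K * `|x - y| <= e.
  rewrite ler_pdivlMr// in xy; apply: le_trans xy; rewrite mulrC.
  by rewrite ler_wpM2l// (le_trans (ler_norm K))// lerDl.
rewrite ler_norml; have := hK x y; have := hK y x; rewrite (distrC y).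
by lra.
Unshelve. all: by end_near. Qed.

Section norms.
Context {R : realType} {d : nat} (N : 'rV[R]_d -> R) (normN : is_norm N).
Implicit Types u v g : 'rV[R]_d.

Lemma is_norm0 : N 0 = 0.
Proof. by rewrite -(scale0r 0) (norm_scale normN) normr0 mul0r. Qed.

Lemma is_normN v : N (- v) = N v.
Proof. by rewrite -scaleN1r (norm_scale normN) normrN1 mul1r. Qed.

Lemma is_norm_ge0 v : 0 <= N v.
Proof.
have := norm_triangle normN v (- v); rewrite subrr is_norm0 is_normN.
by lra.
Qed.

Lemma is_norm_gt0 v : v != 0 -> 0 < N v.
Proof.
move=> v0; rewrite lt_neqAle is_norm_ge0 andbT eq_sym.
by apply: contra v0 => /eqP/(norm_separated normN)/eqP.
Qed.

(** Expand [v] in the standard basis; [C] is the sum of the norms of the basis vectors. *)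
Lemma is_norm_le : exists2 C : R, 0 <= C & forall v, N v <= C * `|v|.
Proof.
exists (\sum_(i < d) N (delta_mx 0 i)).
  by apply: sumr_ge0 => i _; exact: is_norm_ge0.
move=> v; rewrite {1}(row_sum_delta v) mulr_suml.
have : N (\sum_j v 0 j *: delta_mx 0 j)
    <= \sum_j N (v 0 j *: delta_mx 0 j).
  elim/big_ind2: _ => [|a b a' b' ab ab'|//]; first by rewrite is_norm0.
  by rewrite (le_trans (norm_triangle normN _ _))// lerD.
move=> /le_trans; apply; apply: ler_sum => i _.
rewrite (norm_scale normN) mulrC ler_wpM2l ?is_norm_ge0//.
rewrite [`|v|]mx_normrE.
exact: (@le_bigmax _ _ _ 0 (fun ij => `|v ij.1 ij.2|) (0, i)).
Qed.

Lemma is_norm_continuous : continuous N.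
Proof.
have [C _ NC] := is_norm_le; apply: (@lipschitz_cts _ _ C) => u v.
apply: le_trans (NC (u - v)); rewrite lerBlDr.
by rewrite (le_trans _ (norm_triangle normN _ _))// subrK.
Qed.

(** By compactness [N] attains a positive minimum on the unit sphere of the sup-norm, and [C] is its
    inverse. *)
Lemma is_norm_ge : exists2 C : R, 0 < C & forall v, `|v| <= C * N v.
Proof.
pose S : set 'rV[R]_d := [set v | `|v| = 1].
(* The sphere is empty exactly in dimension zero, where every vector is [0]. *)
have [S0|S0] := pselect (S !=set0); last first.
  exists 1 => // v; have [->|v0] := eqVneq v 0.
    by rewrite normr0 mul1r is_norm_ge0.
  exfalso; apply: S0; exists (`|v|^-1 *: v).
  by rewrite /S/= normrZ normfV normr_id mulVf// normr_eq0.
have cS : compact S.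
  apply: bounded_closed_compact.
    by exists 1; split => // x x1 v /= ->; exact: ltW.
  have -> : S = (fun v : 'rV[R]_d => `|v|) @^-1` [set 1] by [].
  by apply: closed_comp => [v _|]; [exact: norm_continuous|exact: closed_eq].
have cN : {within S, continuous N}.
  by apply: continuous_subspaceT; exact: is_norm_continuous.
have [a /set_mem Sa amin] := compact_EVT_min S0 cS cN.
have Na : 0 < N a.
  by apply: is_norm_gt0; rewrite -normr_eq0 Sa oner_eq0.
exists (N a)^-1; first by rewrite invr_gt0.
move=> v; have [->|v0] := eqVneq v 0.
  by rewrite normr0 mulr_ge0 ?is_norm_ge0// invr_ge0 is_norm_ge0.
have Sv : `|v|^-1 *: v \in S.
  by rewrite inE /S/= normrZ normfV normr_id mulVf// normr_eq0.
have := amin _ Sv; rewrite (norm_scale normN) normfV normr_id.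
by rewrite !ler_pdivlMl ?normr_gt0// mulrC.
Qed.

(** The unit ball of [N] is bounded by equivalence of norms; this makes the real-valued [sup] in
    [dual_norm] meaningful. *)
Lemma dual_norm_has_sup g : has_sup [set dot g v | v in [set v | N v <= 1]].
Proof.
split; first by exists (dot g 0), 0 => //=; rewrite is_norm0.
have [C C0 NC] := is_norm_ge.
exists (d%:R * `|g| * C) => _ [v /= Nv <-].
rewrite (le_trans (ler_norm _))// (le_trans (dot_le_norm _ _))// ler_wpM2l//.
by rewrite (le_trans (NC v))// -[leRHS]mulr1 ler_pM2l.
Qed.

Lemma dual_norm_ge0 g : 0 <= dual_norm N g.
Proof.
have [_ ub] := dual_norm_has_sup g.
by apply: ub_le_sup => //; exists 0; rewrite /= ?is_norm0// dot0r.
Qed.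

Lemma dot_le_dual g v : dot g v <= dual_norm N g * N v.
Proof.
have [->|v0] := eqVneq v 0; first by rewrite dot0r is_norm0 mulr0.
have Nv := is_norm_gt0 v0.
rewrite -ler_pdivrMr// mulrC -dotZr.
have [_ ub] := dual_norm_has_sup g; apply: ub_le_sup => //.
exists ((N v)^-1 *: v) => //=.
by rewrite (norm_scale normN) gtr0_norm ?invr_gt0// mulVf ?gt_eqF.
Qed.

Lemma dual_norm_le g K : (forall v, N v <= 1 -> dot g v <= K) ->
  dual_norm N g <= K.
Proof.
move=> gK; apply: ge_sup; first by have [] := dual_norm_has_sup g.
by move=> _ [v /= Nv <-]; exact: gK.
Qed.

(** Splitting [u] as [(u - v) + v] inside [dot u w], with [w] in the bounded unit ball, gives a
    Lipschitz bound. *)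
Lemma dual_norm_continuous : continuous (dual_norm N).
Proof.
have [C C0 NC] := is_norm_ge.
apply: (@lipschitz_cts _ _ (d%:R * C)) => u v; rewrite lerBlDr.
apply: dual_norm_le => w Nw; rewrite -(subrK v u) dotDl subrK lerD//.
  rewrite (le_trans (ler_norm _))// (le_trans (dot_le_norm _ _))//.
  rewrite mulrAC ler_wpM2r// ler_wpM2l// (le_trans (NC w))//.
  by rewrite -[leRHS]mulr1 ler_pM2l.
rewrite (le_trans (dot_le_dual _ _))// -[leRHS]mulr1.
by rewrite ler_wpM2l// dual_norm_ge0.
Qed.

Lemma dual_norm0 : dual_norm N 0 = 0.
Proof.
apply/eqP; rewrite eq_le dual_norm_ge0 andbT.
by apply: dual_norm_le => v _; rewrite dot0l.
Qed.

Lemma dual_norm_gt0 g : g != 0 -> 0 < dual_norm N g.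
Proof.
move=> g0; rewrite lt_neqAle dual_norm_ge0 andbT eq_sym.
apply: contra g0 => /eqP g0; apply/eqP/dot_self_eq0/eqP.
rewrite eq_le sumr_ge0 ?andbT => [|i _]; last by rewrite -expr2 sqr_ge0.
by rewrite (le_trans (dot_le_dual _ _))// g0 mul0r.
Qed.

End norms.

(** * The Polyak stepsize *)

Section polyak_step.
Context {R : realType} {d : nat} {N : 'rV[R]_d -> R} (normN : is_norm N).
Implicit Types (h : 'rV[R]_d -> R) (x y : 'rV[R]_d).

Lemma infimum_le h x : (Defs.infimum h <= (h x)%:E)%E.
Proof. by apply: ereal_inf_lbound; exists x. Qed.

(** The quadratic upper bound along a direction [v] with [N v <= 1] cannot fall below [m];
    minimising it over the step length bounds [dot g v ^+ 2]. *)
Lemma dual_norm_gradient_le L h m y : 0 < L -> differentiable h y ->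
  smooth N L h -> Defs.infimum h = m%:E ->
  dual_norm N (gradient h y) ^+ 2 <= 2 * L * (h y - m).
Proof.
move=> L0 dh sh hm.
have mh u : m <= h u by rewrite -lee_fin -hm infimum_le.
have hy0 : 0 <= h y - m by rewrite subr_ge0.
(* Taking square roots reduces the claim to a bound on [dot g v] for each [v] in the unit ball. *)
rewrite -[leRHS]sqr_sqrtr ?mulr_ge0 ?(ltW L0)//.
rewrite ler_sqr ?nnegrE ?sqrtr_ge0 ?dual_norm_ge0//.
apply: (dual_norm_le normN) => v Nv; set g := gradient h y.
rewrite (le_trans (ler_norm _))// -sqrtr_sqr ler_wsqrtr//.
(* Descent along [v] by the minimiser [<g, v> / L] of the quadratic upper bound. *)
pose t := dot g v / L.
have := sh (y - t *: v) y; rewrite /bregman -/g.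
have -> : y - t *: v - y = - (t *: v) by rewrite addrAC subrr add0r.
rewrite dotNr dotZr (is_normN normN) (norm_scale normN) exprMn real_normK ?num_real//.
have := mh (y - t *: v).
have tL : t * L = dot g v by rewrite /t mulfVK ?gt_eqF.
have : N v ^+ 2 <= 1 by rewrite expr_le1// (is_norm_ge0 normN).
move: (N v ^+ 2) => n n1; rewrite -tL => mu hu.
have : t ^+ 2 * n <= t ^+ 2 by rewrite ler_piMr// sqr_ge0.
move=> tn.
have : L / 2 * (t ^+ 2 * n) <= L / 2 * t ^+ 2 by rewrite ler_wpM2l// divr_ge0// ltW.
move=> Ltn.
have : t ^+ 2 * L / 2 <= h y - m by lra.
move=> /(ler_wpM2l (ltW L0)); lra.
Qed.

(** A point attaining the infimum minimises [h] over the whole space; first-order optimality tested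
    at [y - gradient h y] then makes the gradient vanish. *)
Lemma infimum_lt h y : differentiable h y -> gradient h y != 0 ->
  (Defs.infimum h < (h y)%:E)%E.
Proof.
move=> dh; apply: contraNT; rewrite -leNgt => hy.
apply/eqP/dot_self_eq0/eqP; rewrite eq_le; apply/andP; split; last first.
  by apply: sumr_ge0 => i _; rewrite -expr2 sqr_ge0.
have ymin : is_argmin setT (fun u => h u - dot 0 u) y.
  split => // u _; rewrite !dot0l !subr0 -lee_fin.
  exact: le_trans hy (infimum_le _ _).
have cT : convex_set [set: 'rV[R]_d] by move=> ? ? ? _ _; rewrite inE.
have := argmin_gradient (u := y - gradient h y) cT ymin dh I.
by rewrite subr0 addrAC subrr add0r dotNr oppr_ge0.
Qed.

Lemma polyak_stepE mu_psi c eta_b h y m : 0 < c -> Defs.infimum h = m%:E ->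
  gradient h y != 0 ->
  polyak_step N mu_psi c eta_b h y =
  Num.min (mu_psi * (h y - m) / (c * dual_norm N (gradient h y) ^+ 2)) eta_b.
Proof.
move=> c0 hm g0; rewrite /polyak_step (negbTE g0) hm.
have cd : c * dual_norm N (gradient h y) ^+ 2 != 0.
  by rewrite gt_eqF// mulr_gt0// exprn_gt0// dual_norm_gt0.
by rewrite inver (negbTE cd) -EFinB -!EFinM -EFin_min.
Qed.

Lemma polyak_step_gt0 mu_psi c eta_b h y : 0 < mu_psi -> 0 < c -> 0 < eta_b ->
  differentiable h y -> 0 < polyak_step N mu_psi c eta_b h y.
Proof.
move=> mu0 c0 eta0 dh; have [g0|g0] := eqVneq (gradient h y) 0.
  by rewrite /polyak_step g0 eqxx.
have cd : 0 < c * dual_norm N (gradient h y) ^+ 2.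
  by rewrite mulr_gt0// exprn_gt0// dual_norm_gt0.
have := infimum_lt dh g0; case hm : (Defs.infimum h) => [m||]// my.
  rewrite lte_fin in my; rewrite (polyak_stepE _ _ c0 hm g0) lt_min eta0 andbT.
  by rewrite divr_gt0// mulr_gt0// subr_gt0.
(* Infimum [-oo]: the quotient is [+oo] and the minimum is [eta_b]. *)
rewrite /polyak_step (negbTE g0) hm inver gt_eqF//=.
by rewrite gt0_muley ?lte_fin// gt0_mulye ?lte_fin ?invr_gt0// min_r ?leey.
Qed.

(** Smoothness gives the lower bound through [dual_norm_gradient_le]; the other two come from the
    minimum. The third is written without division so that it also covers a vanishing gradient. *)
Lemma polyak_step_bounds L mu_psi c eta_b h y m :
  0 < L -> 0 < mu_psi -> 0 < c -> 0 < eta_b ->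
  differentiable h y -> smooth N L h -> Defs.infimum h = m%:E ->
  let eta := polyak_step N mu_psi c eta_b h y in
  [/\ Num.min (mu_psi / (2 * c * L)) eta_b <= eta, eta <= eta_b &
    c * (eta * dual_norm N (gradient h y) ^+ 2) <= mu_psi * (h y - m)].
Proof.
move=> L0 mu0 c0 eta0 dh sh hm /=.
have hy0 : 0 <= h y - m by rewrite subr_ge0 -lee_fin -hm infimum_le.
have [g0|g0] := eqVneq (gradient h y) 0.
  rewrite /polyak_step g0 eqxx ge_min lexx orbT; split => //.
  by rewrite (dual_norm0 normN) expr0n/= !mulr0 mulr_ge0 ?(ltW mu0).
have dn0 := dual_norm_gt0 normN g0.
have cd : 0 < c * dual_norm N (gradient h y) ^+ 2.
  by rewrite mulr_gt0// exprn_gt0.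
rewrite (polyak_stepE _ _ c0 hm g0); split.
- have dnL := dual_norm_gradient_le L0 dh sh hm.
  rewrite le_min !ge_min lexx orbT andbT ler_pdivlMr//.
  rewrite mulrAC ler_pdivrMr ?mulr_gt0// -!mulrA ler_pM2l//.
  by have := ler_wpM2l (ltW c0) dnL; lra.
- by rewrite ge_min lexx orbT.
- by rewrite mulrCA -ler_pdivlMr// ge_min lexx.
Qed.

End polyak_step.

(** * The mirror map *)

Section mirror_map.
Context {R : realType} {d : nat}.
Context (N : 'rV[R]_d -> R) (mu_psi : R) (X D : set 'rV[R]_d)
  (psi : 'rV[R]_d -> R).
Implicit Types (u v y z g : 'rV[R]_d) (eta : R).

Definition tilt v u := psi u - dot v u.

(** Under the hypotheses below, this is the gradient at [v] of the convex conjugate of [psi]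
    restricted to [X]; by [mirror_mapP] the default [0] is never taken. *)
Definition mirror_map v : 'rV[R]_d :=
  xget 0 [set z | is_argmin X (tilt v) z /\ D° z].

(** The two objectives differ by the positive factor [eta^-1] and a constant in [u], so the step
    depends on its data only through one dual vector. *)
Lemma mirror_step_tilt g eta y z : 0 < eta ->
  mirror_step psi X g eta y z <->
  is_argmin X (tilt (gradient psi y - eta *: g)) z.
Proof.
move=> eta0.
have E u : dot g u + eta^-1 * bregman psi u y = eta^-1 *
    (tilt (gradient psi y - eta *: g) u
     + (dot (gradient psi y) y - psi y)).
  rewrite /bregman /tilt dotBl dotBr dotZl.
  by field; rewrite gt_eqF.
have le_E u w : (dot g u + eta^-1 * bregman psi u y <=
    dot g w + eta^-1 * bregman psi w y) =
    (tilt (gradient psi y - eta *: g) u <= tilt (gradient psi y - eta *: g) w).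
  by rewrite !E ler_pM2l ?invr_gt0// lerD2r.
by split => -[Xz zmin]; split => // w /zmin; rewrite le_E.
Qed.

Context (normN : is_norm N) (mu_psi_gt0 : 0 < mu_psi) (X_convex : convex_set X)
  (psi_diff : forall y, D° y -> differentiable psi y)
  (psi_strongly_convex : strongly_convex N mu_psi X D psi)
  (psi_interior : interior_condition psi X D)
  (x1 : 'rV[R]_d) (x1_X : X x1) (x1_D : D° x1).

(** The increase of [tilt v] from [z] to [u] is [bregman psi u z] plus the first-order term, which
    is nonnegative at a minimiser. *)
Lemma tilt_growth v z u : is_argmin X (tilt v) z -> D° z -> X u ->
  mu_psi / 2 * N (u - z) ^+ 2 <= tilt v u - tilt v z.
Proof.
move=> zmin Dz Xu; have [Xz _] := zmin.
apply: le_trans (psi_strongly_convex Xu Xz Dz) _.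
have := argmin_gradient X_convex zmin (psi_diff Dz) Xu.
by rewrite /bregman /tilt dotBl [dot v _]dotBr; lra.
Qed.

(** Only [z] is asked to be interior: this identifies an arbitrary mirror step with the one supplied
    by the interior condition. *)
Lemma argmin_tilt_unique v z u : is_argmin X (tilt v) z -> D° z ->
  is_argmin X (tilt v) u -> u = z.
Proof.
move=> zmin Dz [Xu umin]; have := tilt_growth zmin Dz Xu.
have := umin _ zmin.1 => uz zu.
have : mu_psi / 2 * N (u - z) ^+ 2 <= 0 by lra.
rewrite pmulr_rle0 ?divr_gt0// => N0.
have /eqP : N (u - z) ^+ 2 = 0 by apply/eqP; rewrite eq_le N0 sqr_ge0.
by rewrite expf_eq0/= => /eqP/(norm_separated normN)/eqP; rewrite subr_eq0 => /eqP.
Qed.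

(** Every [v] arises from a mirror step out of [x1] with stepsize one along
    [gradient psi x1 - v]. *)
Lemma mirror_mapP v : is_argmin X (tilt v) (mirror_map v) /\ D° (mirror_map v).
Proof.
have [z [zs Dz]] := psi_interior (gradient psi x1 - v) x1_X x1_D ltr01.
move/mirror_step_tilt : zs => /(_ ltr01); rewrite scale1r subKr => zmin.
by apply: (@xgetPex _ 0 [set z | is_argmin X (tilt v) z /\ D° z]); exists z.
Qed.

Lemma mirror_step_map g eta y z : 0 < eta ->
  mirror_step psi X g eta y z -> z = mirror_map (gradient psi y - eta *: g).
Proof.
move=> eta0 /(mirror_step_tilt _ _ _ eta0) zmin.
by have [mmin Dm] := mirror_mapP (gradient psi y - eta *: g);
  exact: argmin_tilt_unique mmin Dm zmin.
Qed.

(** Adding the growth inequalities of the two minimisers gives [mu_psi * N (a - b) ^+ 2 <= dot (u -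
    v) (a - b)]; equivalence of norms turns this into a Lipschitz bound. *)
Lemma mirror_map_continuous i : continuous (fun v => mirror_map v 0 i).
Proof.
have [C C0 NC] := is_norm_ge normN.
apply: (@lipschitz_cts _ _ (C * (d%:R * C / mu_psi))) => u v.
have [[Xu umin] Du] := mirror_mapP u; have [[Xv vmin] Dv] := mirror_mapP v.
have := tilt_growth (conj Xu umin) Du Xv.
have := tilt_growth (conj Xv vmin) Dv Xu.
rewrite /tilt; set a := mirror_map u; set b := mirror_map v.
rewrite -(is_normN normN (a - b)) opprB; set n := N (b - a) => h1 h2.
have nE : n = N (a - b) by rewrite -(is_normN normN (a - b)) opprB.
have n0 : 0 <= n by exact: is_norm_ge0.
have h3 : mu_psi * n ^+ 2 <= dot (u - v) (a - b).
  by rewrite dotBl !dotBr; lra.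
have h4 : mu_psi * n ^+ 2 <= d%:R * C * `|u - v| * n.
  apply: le_trans h3 _; rewrite (le_trans (ler_norm _))//.
  rewrite (le_trans (dot_le_norm _ _))//.
  have := ler_wpM2l (mulr_ge0 (ler0n R d) (normr_ge0 (u - v))) (NC (a - b)).
  by rewrite -nE; lra.
have h5 : n <= d%:R * C / mu_psi * `|u - v|.
  move: n0; rewrite le_eqVlt => /orP[/eqP<-|n0].
    by rewrite mulr_ge0// divr_ge0 ?(ltW mu_psi_gt0)// mulr_ge0// ltW.
  rewrite mulrAC ler_pdivlMr// -(ler_pM2r n0) [n * _]mulrC -mulrA -expr2.
  exact: h4.
have -> : a 0 i - b 0 i = (a - b) 0 i by rewrite !mxE.
rewrite (le_trans (ler_norm _))// (@le_trans _ _ `|a - b|)//.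
  rewrite [leRHS]mx_normrE.
  exact: (@le_bigmax _ _ _ 0 (fun ij => `|(a - b) ij.1 ij.2|) (0, i)).
by rewrite (le_trans (NC _))// -nE -mulrA ler_pM2l.
Qed.

(** The three-point inequality leaves [eta * dot g (y - z)] minus [bregman psi z y]; Young's
    inequality splits the former, and strong convexity absorbs its quadratic part. *)
Lemma mirror_map_bregman y g eta xs : X y -> D° y -> 0 < eta -> X xs ->
  bregman psi xs (mirror_map (gradient psi y - eta *: g)) <=
  bregman psi xs y - eta * dot g (y - xs)
  + eta ^+ 2 * dual_norm N g ^+ 2 / (2 * mu_psi).
Proof.
move=> Xy Dy eta0 Xs.
have [zmin Dz] := mirror_mapP (gradient psi y - eta *: g).
set z := mirror_map _ in zmin Dz *; have [Xz _] := zmin.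
have h1 := argmin_gradient X_convex zmin (psi_diff Dz) Xs.
have h2 := psi_strongly_convex Xz Xy Dy.
have h3 : eta * dot g (y - z) <=
    eta ^+ 2 * dual_norm N g ^+ 2 / (2 * mu_psi) + mu_psi / 2 * N (z - y) ^+ 2.
  rewrite -(is_normN normN (z - y)) opprB.
  apply: (@le_trans _ _ (eta * (dual_norm N g * N (y - z)))).
    by rewrite ler_pM2l// dot_le_dual.
  (* Young's inequality, as the nonnegativity of a square. *)
  have : 0 <= (eta * dual_norm N g - mu_psi * N (y - z)) ^+ 2 / (2 * mu_psi).
    by rewrite divr_ge0 ?sqr_ge0// mulr_ge0// ltW.
  move: (dual_norm N g) (N (y - z)) => a b.
  suff -> : (eta * a - mu_psi * b) ^+ 2 / (2 * mu_psi) =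
    eta ^+ 2 * a ^+ 2 / (2 * mu_psi) + mu_psi / 2 * b ^+ 2 - eta * (a * b) by lra.
  by field; rewrite gt_eqF.
move: h1 h2 h3; rewrite /bregman !(dotBl, dotBr, dotZl).
by lra.
Qed.

End mirror_map.

(** * Measurability of vector-valued maps *)

Section grid.
Context {R : realType} {d : nat}.
Implicit Types (y : 'rV[R]_d) (n : nat).

(** Indices are integer vectors because these form a countable type. *)
Definition grid_point n (k : 'rV[int]_d) : 'rV[R]_d :=
  \row_i ((k 0 i)%:~R / n.+1%:R).

Definition grid_index n y : 'rV[int]_d := \row_i Num.floor (n.+1%:R * y 0 i).

Lemma grid_dist n y : `|y - grid_point n (grid_index n y)| <= n.+1%:R^-1.
Proof.
rewrite [leLHS]mx_normrE; apply/bigmax_leP; split => // -[i j] _ /=.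
rewrite !mxE (ord1 i); have := floor_itv (n.+1%:R * y 0 j).
set f := (Num.floor _)%:~R; rewrite intrD -/f => /andP[h1 h2].
have n0 : 0 < n.+1%:R :> R by [].
rewrite -(ler_pM2l n0) divff ?gt_eqF// -{1}[n.+1%:R](gtr0_norm n0) -normrM.
rewrite mulrBr mulrCA divff ?gt_eqF// mulr1 ger0_norm; first by lra.
by rewrite subr_ge0.
Qed.

Lemma grid_cvg y : grid_point n (grid_index n y) @[n --> \oo] --> y.
Proof.
apply/cvgrPdist_le => e e0; near=> n.
rewrite (le_trans (grid_dist _ _))//.
apply: ltW; near: n; exact: (near_infty_natSinv_lt (PosNum e0)).
Unshelve. all: by end_near. Qed.

End grid.

Section vector_measurability.
Context {dT : measure_display} {T : measurableType dT} {R : realType} {d : nat}.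
Implicit Types (Z : T -> 'rV[R]_d) (K : 'rV[R]_d -> T -> R) (A : set T).

(* Coordinatewise measurability: no sigma-algebra on R^d is needed, since [Z] is
   the pointwise limit of its roundings to the grids of mesh 1/(n+1), which take
   countably many values. *)
Definition measurable_rV A Z := forall i, measurable_fun A (fun w => Z w 0 i).

(** A preimage splits into countably many pieces according to the value of the index. *)
Lemma measurable_fun_countable_index {d' : measure_display}
    {U : measurableType d'} (I : countType) A (k : T -> I) (K : I -> T -> U) :
  (forall q, measurable (A `&` k @^-1` [set q])) ->
  (forall q, measurable_fun A (K q)) -> measurable_fun A (fun w => K (k w) w).
Proof.
move=> mk mK mA B mB.
rewrite (_ : _ `&` _ =
    \bigcup_q ((A `&` k @^-1` [set q]) `&` (A `&` K q @^-1` B))).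
  apply: countable_bigcupT_measurable => [|q]; first exact: countableP.
  by apply: measurableI => //; exact: mK.
apply/seteqP; split => [w [Aw Bw]|w [q _ [[Aw /= <-] [_ Bw]]]] //.
by exists (k w).
Qed.

Lemma measurable_grid_index A Z n q : measurable A -> measurable_rV A Z ->
  measurable (A `&` (fun w => grid_index n (Z w)) @^-1` [set q]).
Proof.
move=> mA mZ.
(* Each floor equals [q 0 i] exactly when the scaled coordinate lies in a half-open unit
   interval. *)
rewrite (_ : _ `&` _ = A `&` \bigcap_(i in [set: 'I_d]) (A `&`
    (fun w => n.+1%:R * Z w 0 i) @^-1` `[(q 0 i)%:~R, (q 0 i + 1)%:~R[)).
  apply: measurableI => //.
  apply: fin_bigcap_measurable => [|i _]; first exact: finite_finset.
  by apply: measurable_funM => //; exact: measurable_cst.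
apply/seteqP; split => [w /= [Aw <-]|w /= [Aw qw]]; split => //.
  by move=> i _; split => //=; rewrite in_itv/= mxE floor_itv.
apply/rowP => i; rewrite mxE; apply/eqP.
by have [_] := qw i I; rewrite /= in_itv/= floor_eq.
Qed.

Lemma measurable_grid {d' : measure_display} {U : measurableType d'} A Z n
    (K : 'rV[R]_d -> T -> U) :
  measurable A -> measurable_rV A Z -> (forall q, measurable_fun A (K q)) ->
  measurable_fun A (fun w => K (grid_point n (grid_index n (Z w))) w).
Proof.
move=> mA mZ mK; apply: (measurable_fun_countable_index (I := 'rV[int]_d)
  (k := fun w => grid_index n (Z w)) (K := fun q => K (grid_point n q))) => //.
by move=> q; exact: measurable_grid_index.
Qed.

(** Replace [Z w] by its grid rounding and let the mesh tend to zero. Continuity is asked only at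
    [Z w], to allow functions that are regular on an open set. *)
Lemma measurable_caratheodory A Z K :
  measurable A -> measurable_rV A Z -> (forall q, measurable_fun A (K q)) ->
  (forall w, A w -> {for Z w, continuous (K ^~ w)}) ->
  measurable_fun A (fun w => K (Z w) w).
Proof.
move=> mA mZ mK cK.
apply: (@measurable_fun_cvg _ _ _ _
  (fun n w => K (grid_point n (grid_index n (Z w))) w)).
  by move=> n; exact: measurable_grid.
move=> w Aw; exact: cvg_comp (@grid_cvg _ _ (Z w)) (cK w Aw).
Qed.

Lemma measurable_rV_open Z (O : set 'rV[R]_d) :
  measurable_rV setT Z -> open O -> measurable (Z @^-1` O).
Proof.
move=> mZ oO.
(* The radius exceeds the rounding error [1/(n+1)], so the ball around the rounding of [Z w]
   contains [Z w]. *)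
pose B n (q : 'rV[R]_d) := `[< ball q (2 / n.+1%:R) `<=` O >].
rewrite (_ : _ @^-1` _ = \bigcup_n (setT `&`
    (fun w => B n (grid_point n (grid_index n (Z w)))) @^-1` [set true])).
  apply: bigcupT_measurable => n.
  by apply: (@measurable_grid _ _ _ _ _ (fun q _ => B n q)).
apply/seteqP; split => [w /= Ow|w [n _ [_ /= /asboolP]]]; last first.
  apply; rewrite -ball_normE/= distrC (le_lt_trans (grid_dist _ _))//.
  by rewrite ltr_pdivlMr// mulVf// ltr1n.
have /nbhs_ballP[e /= e0 eO] : nbhs (Z w) O by exact: open_nbhs_nbhs.
(* The ball around the rounding stays within [2/(n+1) + 2/(n+1)] of [Z w]. *)
have [n ne] : exists n, 4 / n.+1%:R < e.
  have e4 : 0 < e / 4 by rewrite divr_gt0.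
  have [n _ /(_ n (leqnn n)) /=] := near_infty_natSinv_lt (PosNum e4).
  by move=> h; exists n; move: h; rewrite ltr_pdivlMr// mulrC.
exists n => //; split => //=; apply/asboolP => y qy; apply: eO.
apply: (@le_ball _ _ _ (2 / n.+1%:R + 2 / n.+1%:R)).
  by move: ne; set a := n.+1%:R^-1 => ne; lra.
apply: ball_triangle qy; rewrite -ball_normE/=.
by rewrite (le_lt_trans (grid_dist _ _))// ltr_pMl// ltr1n.
Qed.

Lemma measurable_gradient Z K (O : set 'rV[R]_d) i :
  open O -> (forall w, O (Z w)) -> measurable_rV setT Z ->
  (forall q, measurable_fun setT (K q)) ->
  (forall w y, O y -> differentiable (K ^~ w) y) ->
  measurable_fun setT (fun w => gradient (K ^~ w) (Z w) 0 i).
Proof.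
move=> oO OZ mZ mK dK.
pose e : 'rV[R]_d := delta_mx 0 i.
have mZe n : measurable_rV setT (fun w => Z w + n.+1%:R^-1 *: e).
  move=> j; under eq_fun do rewrite mxE.
  by apply: measurable_funD => //; exact: mZ.
pose p n w := if Z w + n.+1%:R^-1 *: e \in O
  then K (Z w + n.+1%:R^-1 *: e) w else 0.
have mp n : measurable_fun setT (p n).
  have mO : measurable ((fun w => Z w + n.+1%:R^-1 *: e \in O) @^-1` [set true]).
    have := measurable_rV_open (mZe n) oO.
    by congr (measurable _); apply/seteqP; split => w /= => [/mem_set|/set_mem].
  apply: measurable_fun_if => //.
  - by apply: (measurable_fun_bool true); rewrite setTI.
  - rewrite setTI; apply: measurable_caratheodory => //.
    + by move=> j; apply: measurable_funTS; exact: mZe.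
    + by move=> q; apply: measurable_funTS; exact: mK.
    + by move=> w /= /set_mem Ow; apply: differentiable_continuous; exact: dK.
apply: (@measurable_fun_cvg _ _ _ _
    (fun n w => n.+1%:R * (p n w - K (Z w) w))) => [n|w _].
  apply: measurable_funM => //; apply: measurable_funB => //.
  apply: measurable_caratheodory => // w _.
  by apply: differentiable_continuous; exact: dK.
have := @gradient_cvg _ _ _ _ e (dK w _ (OZ w)).
have -> : dot (gradient (K ^~ w) (Z w)) e = gradient (K ^~ w) (Z w) 0 i.
  rewrite /dot (bigD1 i)//= big1 ?addr0.
    by rewrite /e [delta_mx _ _ _ _]mxE !eqxx mulr1.
  by move=> j ji; rewrite /e [delta_mx _ _ _ _]mxE (negbTE ji) andbF mulr0.
apply: cvg_trans; apply: near_eq_cvg.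
have : Z w + n.+1%:R^-1 *: e @[n --> \oo] --> Z w.
  rewrite -[X in _ --> X]addr0 -(scale0r e).
  by apply: cvgD; [exact: cvg_cst|exact: cvgZ cvg_harmonic (cvg_cst e)].
move=> /(_ _ (open_nbhs_nbhs (conj oO (OZ w)))) nO.
by near=> n; rewrite /p ifT//; apply/mem_set; near: n.
Unshelve. all: by end_near. Qed.

Lemma measurable_infimum K : (forall q, measurable_fun setT (K q)) ->
  (forall w, continuous (K ^~ w)) ->
  measurable_fun setT (fun w => Defs.infimum (K ^~ w)).
Proof.
move=> mK cK.
(* An enumeration of all grid points of all meshes: by continuity this countable dense family has
   the same infimum. *)
pose q n : 'rV[R]_d :=
  if @unpickle (nat * 'rV[int]_d)%type n is Some mk then grid_point mk.1 mk.2 else 0.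
rewrite (_ : (fun w => _) = fun w => einfs (fun n => (K (q n) w)%:E) 0).
  apply: measurable_fun_einfs => n; exact/measurable_EFinP.
apply/funext => w; rewrite /einfs/=; apply/eqP; rewrite eq_le; apply/andP; split.
  by apply: le_ereal_inf => _ [n _ <-]; exists (q n).
apply: le_ereal_inf_tmp => _ [y _ <-].
have yw : (K (grid_point n (grid_index n y)) w)%:E @[n --> \oo] --> (K y w)%:E.
  by apply: cvg_EFin; [exact: nearW|exact: cvg_comp (@grid_cvg _ _ y) (cK w y)].
rewrite -(cvg_lim _ yw)//; apply: lime_ge; first by apply/cvg_ex; eexists; exact: yw.
apply: nearW => n; apply: ereal_inf_lbound.
by exists (pickle (n, grid_index n y)) => //; rewrite /q pickleK.
Qed.

End vector_measurability.

(** * Measurability of the stepsize and of the mirror descent step *)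

Section measurable_step.
Context {dT : measure_display} {T : measurableType dT} {R : realType} {d : nat}.
Context (N : 'rV[R]_d -> R) (mu_psi c eta_b : R) (X D : set 'rV[R]_d)
  (psi : 'rV[R]_d -> R).
Implicit Types (Z : T -> 'rV[R]_d) (K : 'rV[R]_d -> T -> R).

(** The relation [mirror_step] turned into a function of the sample and the current point. *)
Definition smd_next (h : 'rV[R]_d -> R) y : 'rV[R]_d :=
  mirror_map X D psi
    (gradient psi y - polyak_step N mu_psi c eta_b h y *: gradient h y).

Context (normN : is_norm N) (mu_psi_gt0 : 0 < mu_psi) (c_gt0 : 0 < c)
  (X_convex : convex_set X)
  (psi_diff : forall y, D° y -> differentiable psi y)
  (psi_strongly_convex : strongly_convex N mu_psi X D psi)
  (psi_interior : interior_condition psi X D)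
  (x1 : 'rV[R]_d) (x1_X : X x1) (x1_D : D° x1).

Lemma smd_next_in h y : X (smd_next h y) /\ D° (smd_next h y).
Proof.
have [[Xz _] Dz] := mirror_mapP psi_interior x1_X x1_D
  (gradient psi y - polyak_step N mu_psi c eta_b h y *: gradient h y).
by split.
Qed.

Lemma measurable_polyak_step Z K : measurable_rV setT Z ->
  (forall q, measurable_fun setT (K q)) ->
  (forall w y, differentiable (K ^~ w) y) ->
  measurable_fun setT (fun w => polyak_step N mu_psi c eta_b (K ^~ w) (Z w)).
Proof.
move=> mZ mK dK; have cK w : continuous (K ^~ w).
  by move=> y; exact: differentiable_continuous.
have mg : measurable_rV setT (fun w => gradient (K ^~ w) (Z w)).
  by move=> i; apply: (measurable_gradient i openT).
have mdn : measurable_fun setT (fun w => dual_norm N (gradient (K ^~ w) (Z w))).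
  apply: (@measurable_caratheodory _ _ _ _ _ _ (fun g _ => dual_norm N g)) => //.
  by move=> w _; exact: dual_norm_continuous.
(* The vanishing of the gradient becomes an equation between measurable real functions. *)
have g0E w : (gradient (K ^~ w) (Z w) == 0) =
    (dual_norm N (gradient (K ^~ w) (Z w)) == 0).
  apply/idP/idP => [/eqP->|]; first by rewrite dual_norm0.
  by apply: contraTT => /(dual_norm_gt0 normN)/lt0r_neq0.
have mB : measurable_fun setT (fun w => gradient (K ^~ w) (Z w) == 0).
  by under eq_fun do rewrite g0E; exact: measurable_fun_eqr.
apply: measurable_fun_if => //.
have mA : measurable
    (setT `&` (fun w => gradient (K ^~ w) (Z w) == 0) @^-1` [set false]).
  exact: mB.
apply: measurableT_comp => //; apply: measurable_mine => //.
apply: emeasurable_funM.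
  apply: emeasurable_funM => //; apply: emeasurable_funB.
    apply/measurable_EFinP; apply: measurable_funTS.
    by apply: measurable_caratheodory => // w _; exact: cK.
  by apply: measurable_funTS; exact: measurable_infimum.
(* Where the gradient is nonzero the denominator is positive, so its extended inverse is the real
   one, which is continuous there. *)
apply: (@eq_measurable_fun _ _ _ _ _
    (fun w => ((c * dual_norm N (gradient (K ^~ w) (Z w)) ^+ 2)^-1)%:E)).
  move=> w /set_mem [_ /= /negbT g0]; rewrite inver ifF//.
  by apply: gt_eqF; rewrite mulr_gt0// exprn_gt0// dual_norm_gt0.
apply/measurable_EFinP.
apply: (@measurable_caratheodory _ _ _ _ _ _
  (fun g _ => (c * dual_norm N g ^+ 2)^-1)) => //.
  by move=> i; exact: measurable_funTS.
move=> w [_ /negbT g0]; apply: (@continuousV _ _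
  (fun g : 'rV[R]_d => c * dual_norm N g ^+ 2)).
  by apply: lt0r_neq0; rewrite mulr_gt0// exprn_gt0// dual_norm_gt0.
apply: continuousM; first exact: cst_continuous.
by apply: continuousM; exact: dual_norm_continuous.
Qed.

Lemma measurable_smd_next Z K : measurable_rV setT Z ->
  (forall w, D° (Z w)) -> (forall q, measurable_fun setT (K q)) ->
  (forall w y, differentiable (K ^~ w) y) ->
  measurable_rV setT (fun w => smd_next (K ^~ w) (Z w)).
Proof.
move=> mZ DZ mK dK i.
apply: (@measurable_caratheodory _ _ _ _ _ _
  (fun v _ => mirror_map X D psi v 0 i)) => //; last first.
  by move=> w _; exact: (mirror_map_continuous normN mu_psi_gt0 X_convex
    psi_diff psi_strongly_convex psi_interior x1_X x1_D).
move=> j.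
rewrite (_ : (fun w => _) = fun w => gradient psi (Z w) 0 j -
    polyak_step N mu_psi c eta_b (K ^~ w) (Z w) * gradient (K ^~ w) (Z w) 0 j).
  2: by apply/funext => w; rewrite !mxE.
apply: measurable_funB.
  apply: (@measurable_gradient _ _ _ _ Z (fun q _ => psi q) D° j) => //.
    exact: open_interior.
apply: measurable_funM; first exact: measurable_polyak_step.
exact: (measurable_gradient j openT).
Qed.

Lemma measurable_bregman Z xs : measurable_rV setT Z -> (forall w, D° (Z w)) ->
  measurable_fun setT (fun w => bregman psi xs (Z w)).
Proof.
move=> mZ DZ; apply: measurable_funB; first apply: measurable_funB => //.
  apply: (@measurable_caratheodory _ _ _ _ _ _ (fun y _ => psi y)) => // w _.
  by apply: differentiable_continuous; exact: psi_diff.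
apply: measurable_sum => i; apply: measurable_funM.
  apply: (@measurable_gradient _ _ _ _ Z (fun q _ => psi q) D° i) => //.
    exact: open_interior.
by under eq_fun do rewrite !mxE; apply: measurable_funB => //; exact: mZ.
Qed.

End measurable_step.

(** * Independence of the past *)

Section history.
Context {R : realType} {dO dS : measure_display}
  {Omega : measurableType dO} {Xi : measurableType dS}
  {P : probability Omega R} {law : probability Xi R}
  (xi : nat -> {RV P >-> Xi}) (xi_iid : iid law xi).

(** Rectangles in the samples of index below [n]: a pi-system generating their joint
    sigma-algebra. *)
Definition cylinders n : set (set Omega) :=
  [set \bigcap_(j < n) xi j @^-1` A j |
    A in [set A : nat -> set Xi | forall j, measurable (A j)]].

(** [Omega] with the sigma-algebra of the first [n] samples: dependence on the past alone becomes
    measurability out of this type. *)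
Definition historyType n := g_sigma_algebraType (cylinders n).

Lemma cylinders_measurable n : cylinders n `<=` measurable.
Proof.
move=> _ [A mA <-]; apply: bigcap_measurableType => j _.
by rewrite -[_ @^-1` _]setTI; exact: measurable_funP.
Qed.

Lemma cylinders_setI n : setI_closed (cylinders n).
Proof.
move=> _ _ [A mA <-] [B mB <-]; exists (fun j => A j `&` B j).
  by move=> j; apply: measurableI; [exact: mA|exact: mB].
by rewrite -bigcapI.
Qed.

Lemma cylindersT n : cylinders n setT.
Proof.
exists (fun=> setT) => //.
by apply/seteqP; split => // w _ j _.
Qed.

Lemma cylinders_succ n : cylinders n `<=` cylinders n.+1.
Proof.
move=> _ [A mA <-]; exists (fun j => if (j < n)%N then A j else setT).
  by move=> j /=; case: ifP.
apply/seteqP; split => w /= h j /=.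
  by move=> jn; have := h j (ltnW jn); rewrite /= jn.
by move=> _; case: ifP => // jn; exact: h.
Qed.

Lemma cylinders_last n B : measurable B -> cylinders n.+1 (xi n @^-1` B).
Proof.
move=> mB; exists (fun j => if j == n then B else setT).
  by move=> j /=; case: ifP.
apply/seteqP; split => w /=.
  by move=> /(_ n (ltnSn n)); rewrite /= eqxx.
by move=> h j _ /=; case: eqP => // ->.
Qed.

Lemma measurable_historyS n {dU : measure_display} {U : measurableType dU}
    (f : Omega -> U) :
  measurable_fun setT (f : historyType n -> U) ->
  measurable_fun setT (f : historyType n.+1 -> U).
Proof.
move=> mf _ B mB.
exact: (sub_sigma_algebra2 (@cylinders_succ n)) (mf measurableT B mB).
Qed.

(** As functions of [E], both sides are finite measures; they agree on cylinders by mutual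
    independence, hence on the sigma-algebra these generate. *)
Lemma history_independent n E B : measurable (E : set (historyType n)) ->
  measurable B -> P (E `&` xi n @^-1` B) = (P E * law B)%E.
Proof.
move=> mE mB; have [xi_law xi_ind] := xi_iid.
have mxB : measurable (xi n @^-1` B).
  by rewrite -[_ @^-1` _]setTI; exact: measurable_funP.
have b0 : 0 <= fine (law B) by rewrite fine_ge0.
pose m1 : {measure set Omega -> \bar R} := mrestr P mxB.
pose m2 : {measure set Omega -> \bar R} := mscale (NngNum b0) P.
have -> : (P E * law B)%E = m2 E.
  by rewrite /m2/= /mscale/= fineK ?fin_num_measure// muleC.
apply: (g_sigma_algebra_measure_unique (cylinders n)
  (@cylinders_measurable n) (fun=> setT) (fun=> cylindersT n) _ m1 m2
  (@cylinders_setI n) _ _ E mE).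
- by rewrite bigcup_const.
- move=> _ [A mA <-]; rewrite /m1/= /mrestr /m2/= /mscale/=.
  rewrite fineK ?fin_num_measure//.
  (* The rectangle [A] extended by [B] at index [n], so that independence applies to [n + 1]
     samples. *)
  pose A' j := if (j < n)%N then A j else B.
  have mA' j : measurable (A' j) by rewrite /A'; case: ifP.
  have A'n : A' n = B by rewrite /A' ltnn.
  have iotaE k : [set` iota 0 k] = `I_k.
    by apply/seteqP; split => j; rewrite /= mem_iota.
  have := xi_ind (iota 0 n.+1) A' (iota_uniq _ _) mA'.
  have := xi_ind (iota 0 n) A (iota_uniq _ _) mA.
  rewrite !iotaE -addn1 iotaD big_cat/= big_seq1 add0n A'n.
  have -> : P (xi n @^-1` B) = law B by exact: xi_law.
  move=> EA; rewrite (_ : (\prod_(j <- iota 0 n) _)%E =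
    P (\bigcap_(j < n) xi j @^-1` A j)); last first.
    rewrite EA big_seq [RHS]big_seq; apply: eq_bigr => j.
    by rewrite mem_iota add0n /= /A' => ->.
  rewrite muleC => <-; congr (P _); apply/seteqP; split => w /=.
    move=> [h wB] j /=; rewrite addn1 ltnS /A' leq_eqVlt.
    by case: ltnP => [jn _|_ /orP[/eqP->|//]] //; exact: h.
  move=> h; split => [j /= jn|].
    by have := h j; rewrite /= /A' jn addn1; apply; exact: ltnW.
  by have := h n; rewrite /= /A' ltnn addn1; exact.
- move=> k; rewrite /m1/= /mrestr/=.
  rewrite (le_lt_trans (probability_le1 _ _)) ?ltry//.
  exact: measurableI.
Qed.

End history.

(** Independence makes the joint law of the past and [xi n] a product measure, and Tonelli's theorem
    lets the fresh sample be integrated first. *)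
Lemma integral_history {R : realType} {dO dS : measure_display}
    {Omega : measurableType dO} {Xi : measurableType dS}
    {P : probability Omega R} {law : probability Xi R}
    (xi : nat -> {RV P >-> Xi}) n (h : historyType xi n * Xi -> \bar R) :
  iid law xi -> measurable_fun setT h -> (forall z, 0 <= h z)%E ->
  (\int[P]_w h (w, xi n w) = \int[P]_w \int[law]_s h (w, s))%E.
Proof.
move=> xi_iid mh h0.
have mid : measurable_fun setT (id : Omega -> historyType xi n).
  move=> _ B mB; rewrite setTI preimage_id.
  have sm := smallest_sub (sigma_algebra_measurable Omega)
    (@cylinders_measurable _ _ _ _ _ _ xi n).
  exact: sm.
pose phi w : historyType xi n * Xi := (w, xi n w).
have mphi : measurable_fun setT phi by apply: measurable_fun_pair.
pose idm : {mfun Omega >-> historyType xi n} :=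
  HB.pack (id : Omega -> historyType xi n) (isMeasurableFun.Build _ _ _ _ _ mid).
pose phim : {mfun Omega >-> (historyType xi n * Xi)%type} :=
  HB.pack phi (isMeasurableFun.Build _ _ _ _ _ mphi).
pose P1 : probability _ R := distribution P idm.
pose P2 : probability _ R := distribution P phim.
have P2E : forall A, measurable A -> P2 A = (P1 \x law)%E A.
  move=> A mA; apply/esym; apply: product_measure_unique => // B C mB mC.
  rewrite -(history_independent xi_iid mB mC).
  by congr (P _).
transitivity (\int[P2]_z h z)%E.
  by rewrite /P2 ge0_integral_distribution.
transitivity (\int[P1 \x law]_z h z)%E.
  by apply: eq_measure_integral => A mA _; exact: P2E.
rewrite fubini_tonelli1// /P1 ge0_integral_distribution//.
  exact: measurable_fun_fubini_tonelli_F.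
by move=> w; exact: integral_ge0.
Qed.

(** * Integrable functions with a prescribed mean *)

Section has_mean.
Context {R : realType} {dS : measure_display} {Xi : measurableType dS}
  (law : probability Xi R).
Implicit Types (h k : Xi -> R) (m a : R).

(** Bundling integrability with a real value gives linearity without side conditions on
    infinities. *)
Definition has_mean h m := law.-integrable setT (EFin \o h) /\
  (\int[law]_s (h s)%:E = m%:E)%E.

Lemma has_mean_cst m : has_mean (fun=> m) m.
Proof.
split; first exact: finite_measure_integrable_cst.
transitivity (m%:E * law setT)%E; first exact: (integral_cst law measurableT).
by rewrite probability_setT mule1.
Qed.

Lemma has_meanD h k m a : has_mean h m -> has_mean k a ->
  has_mean (fun s => h s + k s) (m + a).
Proof.
move=> [ih hm] [ik ka]; split; first exact: (integrableD measurableT ih ik).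
by under eq_integral do rewrite EFinD; rewrite (integralD measurableT ih ik) hm ka.
Qed.

Lemma has_meanZ h m a : has_mean h m -> has_mean (fun s => a * h s) (a * m).
Proof.
move=> [ih hm]; split; first exact: (integrableZl measurableT a ih).
by under eq_integral do rewrite EFinM; rewrite (integralZl measurableT ih) hm.
Qed.

Lemma has_meanB h k m a : has_mean h m -> has_mean k a ->
  has_mean (fun s => h s - k s) (m - a).
Proof.
move=> hm ka; have := has_meanD hm (has_meanZ (-1) ka).
by under eq_fun do rewrite mulN1r; rewrite mulN1r.
Qed.

Lemma has_mean_sum n (h : 'I_n -> Xi -> R) (m : 'I_n -> R) :
  (forall i, has_mean (h i) (m i)) ->
  has_mean (fun s => \sum_i h i s) (\sum_i m i).
Proof.
move=> hm; rewrite (_ : (fun s => _) = \sum_i h i); last first.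
  by apply/funext => s; rewrite fct_sumE.
elim/big_ind2 : _ => [|k a k' a' ka ka'|//]; first exact: has_mean_cst.
exact: has_meanD.
Qed.

End has_mean.

(** * One step of mirror descent *)

Lemma has_mean_le {R : realType} {dS : measure_display}
    {Xi : measurableType dS} (law : probability Xi R) (h : Xi -> R) m a :
  has_mean law h m -> {ae law, forall s, h s <= a} -> m <= a.
Proof.
move=> hm ha; rewrite -subr_ge0 -lee_fin.
have [ik <-] := has_meanB (has_mean_cst law a) hm.
have mk := measurable_int _ ik.
(* The sign of [a - h s] is known only almost everywhere; the positive part is nonnegative
   everywhere and has the same integral. *)
rewrite (@ae_eq_integral _ _ _ _ _ ((fun s => (a - h s)%:E)^\+%E))//.
- by apply: integral_ge0 => s _; exact: funepos_ge0.
- exact: measurable_funepos.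
- apply: filterS ha => s hs _.
  by rewrite funeposE max_l// lee_fin subr_ge0.
Qed.

Section one_step.
Context {R : realType} {d : nat} {dS : measure_display}
  {Xi : measurableType dS} {law : probability Xi R}.
Context {X D : set 'rV[R]_d} {psi : 'rV[R]_d -> R}
  {F : Xi -> 'rV[R]_d -> R} {f : 'rV[R]_d -> R} {N : 'rV[R]_d -> R}
  {L mu mu_psi c eta_b : R} {x1 : 'rV[R]_d}
  (X_convex : convex_set X)
  (psi_diff : forall y, D° y -> differentiable psi y)
  (F_diff : forall s y, differentiable (F s) y)
  (f_mean : forall y, has_mean law (fun s => F s y) (f y))
  (grad_mean : forall y, X y -> forall i : 'I_d,
    has_mean law (fun s => gradient (F s) y 0 i) (gradient f y 0 i))
  (N_norm : is_norm N)
  (L_gt0 : 0 < L)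
  (F_convex_smooth : {ae law, forall s,
    convex_function setT (F s) /\ smooth N L (F s)})
  (mu_gt0 : 0 < mu)
  (f_strongly_convex : relatively_strongly_convex mu X D psi f)
  (mu_psi_gt0 : 0 < mu_psi)
  (psi_strongly_convex : strongly_convex N mu_psi X D psi)
  (psi_interior : interior_condition psi X D)
  (c_ge : 1 / 2 <= c) (eta_b_gt0 : 0 < eta_b)
  (x1_X : X x1) (x1_D : D° x1)
  {xs : 'rV[R]_d} (xs_X : X xs) (noise_finite : (noise law F f xs < +oo)%E).
Implicit Types (y : 'rV[R]_d) (h : 'rV[R]_d -> R).

Local Notation next := (smd_next N mu_psi c eta_b X D psi).
Local Notation alpha := (Num.min (mu_psi / (2 * c * L)) eta_b).

Let c_gt0 : 0 < c. Proof. by apply: lt_le_trans c_ge; lra. Qed.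

Let double_c_ge1 : 1 <= 2 * c. Proof. by move: c_ge; lra. Qed.

Lemma alpha_gt0 : 0 < alpha.
Proof. by rewrite lt_min eta_b_gt0 divr_gt0// !mulr_gt0. Qed.

Lemma bregman_psi_ge0 y : X y -> D° y -> 0 <= bregman psi xs y.
Proof.
move=> Xy Dy; apply: le_trans (psi_strongly_convex xs_X Xy Dy).
by rewrite mulr_ge0 ?sqr_ge0// divr_ge0// ltW.
Qed.

(** Stated in the extended reals: for a sample with infimum [-oo] the right-hand side is [+oo]. *)
Lemma smd_next_bregman h y : convex_function setT h -> smooth N L h ->
  (forall z, differentiable h z) -> X y -> D° y ->
  ((bregman psi xs (next h y))%:E <=
   (bregman psi xs y - alpha * bregman h xs y)%:E
   + eta_b%:E * ((h xs)%:E - Defs.infimum h))%E.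
Proof.
move=> ch sh dh Xy Dy; have := infimum_le h xs.
case hm : (Defs.infimum h) => [m||]//; last first.
  by move=> _; rewrite gt0_muley ?lte_fin// addey// leey.
rewrite lee_fin -EFinB -EFinM -EFinD lee_fin => mxs.
have b0 := convex_bregman_ge0 xs ch (dh y).
have eta0 := polyak_step_gt0 N_norm mu_psi_gt0 c_gt0 eta_b_gt0 (dh y).
have [] := polyak_step_bounds N_norm L_gt0 mu_psi_gt0 c_gt0 eta_b_gt0 (dh y) sh hm.
have := mirror_map_bregman N_norm mu_psi_gt0 X_convex psi_diff
  psi_strongly_convex psi_interior x1_X x1_D (gradient h y) Xy Dy eta0 xs_X.
rewrite -/(smd_next _ _ _ _ _ _ _ _ _).
set eta := polyak_step _ _ _ _ _ _ in eta0 *; set q := dual_norm _ _ ^+ 2.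
move=> B' al_eta eta_etab eta_q.
have q0 : 0 <= eta * q by rewrite mulr_ge0 ?sqr_ge0// ltW.
(* Here [c >= 1/2] enters: it lets the stepsize bound control the quadratic error term. *)
have eq2 : eta ^+ 2 * q / (2 * mu_psi) <= eta * (h y - m).
  rewrite ler_pdivrMr ?mulr_gt0// expr2 -!mulrA ler_pM2l//.
  have : 1 / 2 * (eta * q) <= c * (eta * q) by rewrite ler_wpM2r.
  by lra.
have e1 : alpha * bregman h xs y <= eta * bregman h xs y by rewrite ler_wpM2r.
have e2 : eta * (h xs - m) <= eta_b * (h xs - m).
  by rewrite ler_wpM2r// subr_ge0.
(* Rewriting the linear term through [bregman h xs y] leaves [eta * (h xs - h y)], which combines
   with [eta * (h y - m)] into [eta * (h xs - m)]. *)
apply: (le_trans B'); move: e1 e2 eq2.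
by rewrite /(bregman h) !dotBr; lra.
Qed.

(** The positive part is dominated by the absolute value of [F s xs]; a negative part of infinite
    integral would make the noise [+oo]. *)
Lemma infimum_integrable : law.-integrable setT (fun s => Defs.infimum (F s)).
Proof.
have mF : measurable_fun setT (fun s => Defs.infimum (F s)).
  apply: (measurable_infimum (K := fun q s => F s q)).
    by move=> q; have [/measurable_int/measurable_EFinP] := f_mean q.
  by move=> s q; apply: differentiable_continuous; exact: F_diff.
have [ixs _] := f_mean xs.
apply/integrableP; split => //.
have pos_lty : (\int[law]_s (fun s => Defs.infimum (F s))^\+ s < +oo)%E.
  have /integrableP[mxs ixs_lty] := ixs; apply: le_lt_trans ixs_lty.
  apply: ge0_le_integral => //.
  - exact: measurable_funepos.
  - exact: measurableT_comp.
  - move=> s _; rewrite funeposE ge_max abse_ge0 andbT.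
    by rewrite (le_trans (infimum_le (F s) xs))// lee_abs.
have : (\int[law]_s (fun s => Defs.infimum (F s))^\- s < +oo)%E.
  rewrite ltey; apply: contraTneq noise_finite => neg_y.
  rewrite /noise integralE neg_y.
  have : (\int[law]_s (fun s => Defs.infimum (F s))^\+ s)%E \is a fin_num.
    by rewrite ge0_fin_numE//; apply: integral_ge0 => s _; exact: funepos_ge0.
  by move=> /fineK <-.
move=> neg_lty; rewrite [ltLHS](_ : _ =
  \int[law]_s ((fun s => Defs.infimum (F s))^\+ s
    + (fun s => Defs.infimum (F s))^\- s))%E; last first.
  apply: eq_integral => s _; exact: (congr1 (@^~ s) (fune_abse _)).
rewrite ge0_integralD//.
- exact: lte_add_pinfty.
- exact: measurable_funepos.
- exact: measurable_funeneg.
Qed.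

Lemma noise_fin_num : noise law F f xs \is a fin_num.
Proof.
rewrite /noise fin_numB/=; apply: integrable_fin_num => //.
exact: infimum_integrable.
Qed.

Lemma noise_ge0 : (0 <= noise law F f xs)%E.
Proof.
have [ixs fxs] := f_mean xs; rewrite /noise -fxs sube_ge0.
  apply: le_integral => //; first exact: infimum_integrable.
  by move=> s _; exact: infimum_le.
apply/orP; left.
by apply: integrable_fin_num => //; exact: infimum_integrable.
Qed.

(** At fixed points the Bregman divergence is linear in the function and its gradient. *)
Lemma bregman_mean y : X y ->
  has_mean law (fun s => bregman (F s) xs y) (bregman f xs y).
Proof.
move=> Xy; rewrite /bregman /dot; apply: has_meanB.
  by apply: has_meanB; exact: f_mean.
apply: has_mean_sum => i; rewrite mulrC.
under eq_fun do rewrite mulrC.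
by apply: has_meanZ; exact: grad_mean.
Qed.

(* If [X] has two points then [mu * mu_psi <= L], so that [1 - mu * alpha >= 0];
   otherwise the divergence vanishes. *)
Lemma contraction_ge0 y : X y -> D° y ->
  0 <= (1 - mu * alpha) * bregman psi xs y.
Proof.
move=> Xy Dy; have := bregman_psi_ge0 Xy Dy.
rewrite le_eqVlt => /orP[/eqP<-|B0]; first by rewrite mulr0.
rewrite mulr_ge0 ?(ltW B0)//.
have xsy : xs - y != 0.
  apply: contraTneq B0 => xsy; rewrite /bregman xsy dot0r subr0.
  by rewrite (subr0_eq xsy) subrr ltxx.
have n0 : 0 < N (xs - y) ^+ 2 by rewrite exprn_gt0// is_norm_gt0.
(* Smoothness of almost every sample averages to an upper bound on the divergence of [f]. *)
have h1 : bregman f xs y <= L / 2 * N (xs - y) ^+ 2.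
  apply: (has_mean_le (bregman_mean Xy)).
  by apply: filterS F_convex_smooth => s [_]; exact.
have h2 := f_strongly_convex xs_X Xy Dy.
have h3 := ler_wpM2l (ltW mu_gt0) (psi_strongly_convex xs_X Xy Dy).
have h4 : mu * mu_psi <= L.
  rewrite -(ler_pM2r n0); have := le_trans h3 (le_trans h2 h1).
  by move: (N _ ^+ 2) => n; lra.
have h5 : mu * alpha <= mu * (mu_psi / (2 * c * L)).
  by rewrite ler_pM2l// ge_min lexx.
rewrite subr_ge0 (le_trans h5)// mulrA ler_pdivrMr ?mulr_gt0// mul1r.
by rewrite (le_trans h4)// ler_peMl ?(ltW L_gt0).
Qed.

(** The parameter space is general to cover a fixed point with a varying sample, the past including
    its last sample, and the past paired with a fresh sample. *)
Lemma smd_next_measurable {dT : measure_display} {T : measurableType dT}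
    (Z : T -> 'rV[R]_d) (zeta : T -> Xi) :
  measurable_rV setT Z -> (forall w, D° (Z w)) -> measurable_fun setT zeta ->
  measurable_rV setT (fun w => next (F (zeta w)) (Z w)).
Proof.
move=> mZ DZ mzeta.
apply: (measurable_smd_next (K := fun q w => F (zeta w) q) eta_b N_norm
  mu_psi_gt0 c_gt0 X_convex psi_diff psi_strongly_convex psi_interior x1_X x1_D) => // q.
have mFq : measurable_fun setT (F^~ q).
  by have [/measurable_int/measurable_EFinP] := f_mean q.
exact: measurableT_comp mFq mzeta.
Qed.

Lemma smd_next_mean y : X y -> D° y ->
  (\int[law]_s (bregman psi xs (next (F s) y))%:E <=
   ((1 - mu * alpha) * bregman psi xs y)%:E
   + eta_b%:E * noise law F f xs)%E.
Proof.
move=> Xy Dy.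
have next_in h := smd_next_in N mu_psi c eta_b psi_interior x1_X x1_D h y.
pose b s := bregman psi xs y - alpha * bregman (F s) xs y.
pose k s := (eta_b%:E * ((F s xs)%:E - Defs.infimum (F s)))%E.
have bm : has_mean law b (bregman psi xs y - alpha * bregman f xs y).
  by apply: has_meanB (has_meanZ _ (bregman_mean Xy)); exact: has_mean_cst.
have [ixs fxs] := f_mean xs.
have iB : law.-integrable setT (fun s => (F s xs)%:E - Defs.infimum (F s))%E.
  exact: (integrableB measurableT ixs infimum_integrable).
have ik : law.-integrable setT k by exact: (integrableZl measurableT eta_b iB).
have ibk := integrableD measurableT bm.1 ik.
have kE : (\int[law]_s k s = eta_b%:E * noise law F f xs)%E.
  rewrite (integralZl measurableT iB) (integralB measurableT ixs infimum_integrable).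
  by rewrite fxs.
have m1 : measurable_fun setT (fun s => (bregman psi xs (next (F s) y))%:E).
  apply/measurable_EFinP; apply: (measurable_bregman psi_diff); last first.
    by move=> s; have [_ DF] := next_in (F s); exact: DF.
  exact: (@smd_next_measurable _ _ (fun=> y) id).
have m2 := measurable_int _ ibk.
suff : (\int[law]_s (bregman psi xs (next (F s) y))%:E <=
    \int[law]_s ((b s)%:E + k s))%E.
  move=> /le_trans; apply; rewrite (integralD measurableT bm.1 ik) kE bm.2 leeD2r// lee_fin.
  have := ler_wpM2l (ltW alpha_gt0) (f_strongly_convex xs_X Xy Dy).
  by lra.
have le_bk : {ae law, forall s,
    ((bregman psi xs (next (F s) y))%:E <= (b s)%:E + k s)%E}.
  by apply: filterS F_convex_smooth => s [cs ss]; exact: smd_next_bregman.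
have B0 s : (0 <= (bregman psi xs (next (F s) y))%:E)%E.
  by rewrite lee_fin; have [? ?] := next_in (F s); exact: bregman_psi_ge0.
(* The right-hand side is nonnegative only almost everywhere; its positive part allows comparison of
   nonnegative integrands. *)
rewrite (@ae_eq_integral _ _ _ law setT
  ((fun s => (b s)%:E + k s)^\+)%E (fun s => (b s)%:E + k s)%E) => //.
- apply: ae_ge0_le_integral => //.
  + exact: measurable_funepos.
  + apply: filterS le_bk => s h _.
    by rewrite (le_trans h)// funeposE le_max lexx.
- exact: measurable_funepos.
- apply: filterS le_bk => s h _.
  by rewrite funeposE max_l// (le_trans (B0 s)).
Qed.

End one_step.

(** * Convergence *)

Lemma measurable_history {R : realType} {dO dS dU : measure_display}
    {Omega : measurableType dO} {Xi : measurableType dS}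
    {U : measurableType dU} {P : probability Omega R}
    (xi : nat -> {RV P >-> Xi}) n (g : Omega -> U) :
  measurable_fun setT (g : historyType xi n -> U) -> measurable_fun setT g.
Proof.
move=> mg _ B mB.
have sm := smallest_sub (sigma_algebra_measurable Omega)
  (@cylinders_measurable _ _ _ _ _ _ xi n).
exact: sm (mg measurableT B mB).
Qed.

(* Indices are shifted by one: xi n and x n stand for xi_{n+1} and x_{n+1}, so
   that x 0 is the initial point. The random vector xi is given by its law on
   its support Xi, and F s is the function f_s. *)
Theorem theorem5 (R : realType) (d : nat)
  (dO dS : measure_display)
  (Omega : measurableType dO) (Xi : measurableType dS)
  (P : probability Omega R) (law : probability Xi R)
  (xi : nat -> {RV P >-> Xi})
  (X D : set 'rV[R]_d) (psi : 'rV[R]_d -> R)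
  (F : Xi -> 'rV[R]_d -> R) (f : 'rV[R]_d -> R)
  (N : 'rV[R]_d -> R)
  (L mu mu_psi c eta_b : R)
  (x : nat -> Omega -> 'rV[R]_d) (x1 : 'rV[R]_d)
  (X_nonempty : X !=set0) (X_closed : closed X) (X_convex : convex_set X)
  (X_sub_D : X `<=` D)
  (D_convex : convex_set D) (psi_convex : convex_function D psi)
  (psi_diff : forall y, D° y -> differentiable psi y)
  (F_diff : forall s y, differentiable (F s) y)
  (f_mean : forall y, law.-integrable setT (fun s => (F s y)%:E) /\
    ('E_law[fun s => F s y] = (f y)%:E)%E)
  (f_diff : forall y, differentiable f y)
  (grad_mean : forall y, X y -> forall i : 'I_d,
    law.-integrable setT (fun s => (gradient (F s) y ord0 i)%:E) /\
    ('E_law[fun s => gradient (F s) y ord0 i] = (gradient f y ord0 i)%:E)%E)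
  (minimizers_nonempty : minimizers X f !=set0)
  (noise_finite : forall xstar, minimizers X f xstar ->
    (noise law F f xstar < +oo)%E)
  (N_norm : is_norm N)
  (L_gt0 : 0 < L)
  (F_convex_smooth : {ae law, forall s,
    convex_function setT (F s) /\ smooth N L (F s)})
  (mu_gt0 : 0 < mu)
  (f_strongly_convex : relatively_strongly_convex mu X D psi f)
  (mu_psi_gt0 : 0 < mu_psi)
  (psi_strongly_convex : strongly_convex N mu_psi X D psi)
  (psi_interior : interior_condition psi X D)
  (c_ge : 1 / 2 <= c) (eta_b_gt0 : 0 < eta_b)
  (xi_iid : iid law xi)
  (x1_X : X x1) (x1_D : D° x1)
  (x_init : forall w, x 0%N w = x1)
  (x_step : forall n w,
    mirror_step psi X (gradient (F (xi n w)) (x n w))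
      (polyak_step N mu_psi c eta_b (F (xi n w)) (x n w))
      (x n w) (x n.+1 w)) :
  let alpha := Order.min (mu_psi / (2 * c * L)) eta_b in
  forall xstar, minimizers X f xstar ->
  forall t : nat, (1 <= t)%N ->
  ('E_P[fun w => bregman psi xstar (x t w)]
   <= ((1 - mu * alpha) ^+ t * bregman psi xstar x1)%:E
      + (eta_b / (alpha * mu))%:E * noise law F f xstar)%E.
Proof.
move=> alpha xstar xsm t _; have [xs_X _] := xsm.
have f_mean' y : has_mean law (fun s => F s y) (f y).
  by have [ih hm] := f_mean y; rewrite unlock in hm.
have grad_mean' y : X y -> forall i : 'I_d,
    has_mean law (fun s => gradient (F s) y 0 i) (gradient f y 0 i).
  by move=> Xy i; have [ih hm] := grad_mean y Xy i; rewrite unlock in hm.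
have ns_lty := noise_finite _ xsm.
have ns_ge0 : (0 <= noise law F f xstar)%E.
  exact: (noise_ge0 F_diff f_mean' ns_lty).
have ns_fin : noise law F f xstar \is a fin_num.
  exact: (noise_fin_num F_diff f_mean' ns_lty).
have c_gt0 : 0 < c by apply: lt_le_trans c_ge; lra.
have al_gt0 : 0 < alpha by exact: (alpha_gt0 L_gt0 mu_psi_gt0 c_ge eta_b_gt0).
pose next := smd_next N mu_psi c eta_b X D psi.
have next_in h y := smd_next_in N mu_psi c eta_b psi_interior x1_X x1_D h y.
(* Uniqueness of the mirror step turns the given iterates into an explicit recursion. *)
have xS n w : x n.+1 w = next (F (xi n w)) (x n w).
  apply: (mirror_step_map N_norm mu_psi_gt0 X_convex psi_diff
    psi_strongly_convex psi_interior x1_X x1_D _ (x_step n w)).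
  exact: polyak_step_gt0.
have x_in n w : X (x n w) /\ D° (x n w).
  by case: n => [|n]; [rewrite x_init|rewrite xS; exact: next_in].
have x_X n w := (x_in n w).1; have x_D n w := (x_in n w).2.
have B_ge0 n w : 0 <= bregman psi xstar (x n w).
  exact: (bregman_psi_ge0 mu_psi_gt0 psi_strongly_convex xs_X).
(* [x n] depends only on samples of index below [n], so [xi n] is fresh. *)
have mx n : measurable_rV setT (x n : historyType xi n -> 'rV[R]_d).
  elim: n => [|n IH].
    rewrite (_ : x 0%N = cst x1) => [i|]; first exact: measurable_cst.
    by apply/funext => w; exact: x_init.
  rewrite (_ : x n.+1 = fun w => next (F (xi n w)) (x n w)); last first.
    by apply/funext => w; exact: xS.
  apply: (smd_next_measurable X_convex psi_diff F_diff f_mean' N_norm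
    mu_psi_gt0 psi_strongly_convex psi_interior c_ge x1_X x1_D
    (T := historyType xi n.+1) (zeta := xi n)) => //.
    by move=> i; apply: measurable_historyS; exact: IH.
  by move=> _ B mB; rewrite setTI; apply: sub_sigma_algebra; exact: cylinders_last.
have mB n : measurable_fun setT
    ((fun w => bregman psi xstar (x n w)) : historyType xi n -> R).
  exact: (measurable_bregman psi_diff).
pose E n := (\int[P]_w (bregman psi xstar (x n w))%:E)%E.
have E_step n : (E n.+1 <= \int[P]_w
    (((1 - mu * alpha) * bregman psi xstar (x n w))%:E
    + eta_b%:E * noise law F f xstar))%E.
  pose h (z : historyType xi n * Xi) :=
    (bregman psi xstar (next (F z.2) (x n z.1)))%:E.
  have mh : measurable_fun setT h.
    apply/measurable_EFinP; apply: (measurable_bregman psi_diff); last first.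
      by move=> z; have [_ Dz] := next_in (F z.2) (x n z.1); exact: Dz.
    apply: (smd_next_measurable X_convex psi_diff F_diff f_mean' N_norm
      mu_psi_gt0 psi_strongly_convex psi_interior c_ge x1_X x1_D
      (Z := fun z : historyType xi n * Xi => x n z.1) (zeta := snd)) => //.
    by move=> i; exact: measurableT_comp (mx n i) measurable_fst.
  have h0 z : (0 <= h z)%E.
    rewrite lee_fin; have [Xz Dz] := next_in (F z.2) (x n z.1).
    exact: (bregman_psi_ge0 mu_psi_gt0 psi_strongly_convex xs_X).
  rewrite (_ : E n.+1 = \int[P]_w h (w, xi n w))%E; last first.
    by apply: eq_integral => w _; rewrite xS.
  rewrite (integral_history xi_iid mh h0); apply: ge0_le_integral => //.
  - by move=> w _; exact: integral_ge0.
  - apply: (@measurable_history _ _ _ _ _ _ _ _ xi n).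
    exact: measurable_fun_fubini_tonelli_F.
  - apply: emeasurable_funD => //; apply/measurable_EFinP.
    by apply: measurable_funM => //; exact: (measurable_history (mB n)).
  - move=> w _; rewrite /fubini_F /h/= /next /alpha.
    have step := smd_next_mean X_convex psi_diff F_diff f_mean' grad_mean' N_norm
      L_gt0 F_convex_smooth f_strongly_convex mu_psi_gt0 psi_strongly_convex
      psi_interior c_ge eta_b_gt0 x1_X x1_D xs_X ns_lty (x_X n w) (x_D n w).
    exact: step.
suff : (E t <= ((1 - mu * alpha) ^+ t * bregman psi xstar x1)%:E
      + (eta_b / (alpha * mu))%:E * noise law F f xstar)%E by rewrite unlock.
have contr n w : 0 <= (1 - mu * alpha) * bregman psi xstar (x n w).
  exact: (contraction_ge0 f_mean' grad_mean' N_norm L_gt0 F_convex_smooth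
    mu_gt0 f_strongly_convex mu_psi_gt0 psi_strongly_convex c_ge xs_X).
move: ns_ge0 E_step; rewrite -(fineK ns_fin).
set ns := fine _; rewrite lee_fin => ns_ge0 E_step.
have ns'_ge0 : 0 <= eta_b / (alpha * mu) * ns.
  by rewrite mulr_ge0// divr_ge0 ?(ltW eta_b_gt0)// mulr_ge0// ltW.
(* A negative factor is compatible with [contr] only if the divergence vanishes at all iterates. *)
have [q_ge0|q_lt0] := leP 0 (1 - mu * alpha); last first.
  have B0 n w : bregman psi xstar (x n w) = 0.
    apply/eqP; rewrite eq_le B_ge0 andbT.
    by have := contr n w; rewrite nmulr_rge0.
  rewrite /E; under eq_integral do rewrite B0.
  (* A sample point is needed to transfer the vanishing of the divergence to [x1]; one exists since
     [P] has mass one. *)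
  have [w _] : [set: Omega] !=set0.
    apply/set0P/eqP => O0; have := probability_setT P.
    by rewrite O0 measure0 => /eqP; rewrite eqe eq_sym oner_eq0.
  rewrite integral0 -(x_init w) B0 mulr0 add0e -EFinM lee_fin.
  exact: ns'_ge0.
(* The induction starts at [0], where the noise term only adds a nonnegative amount. *)
elim: t => [|n IH].
  rewrite expr0 mul1r /E; under eq_integral do rewrite x_init.
  by rewrite (has_mean_cst P _).2 -EFinM -EFinD lee_fin lerDl.
apply: le_trans (E_step n) _.
rewrite ge0_integralD//; last first.
- by move=> w _; rewrite -EFinM lee_fin mulr_ge0// ltW.
- apply/measurable_EFinP; apply: measurable_funM => //.
  exact: (measurable_history (mB n)).
- by move=> w _; rewrite lee_fin.
under eq_integral do rewrite EFinM.
rewrite ge0_integralZl_EFin//; last 2 first.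
- by move=> w _; rewrite lee_fin.
- by apply/measurable_EFinP; exact: (measurable_history (mB n)).
rewrite -EFinM (has_mean_cst P _).2 EFinM.
(* The noise term [eta_b / (alpha * mu) * ns] is the fixed point of
   [r -> (1 - mu * alpha) * r + eta_b * ns], so the remaining comparison is an equality. *)
apply: (@le_trans _ _ ((1 - mu * alpha)%:E *
  (((1 - mu * alpha) ^+ n * bregman psi xstar x1)%:E
      + (eta_b / (alpha * mu))%:E * ns%:E) + eta_b%:E * ns%:E)%E).
  by rewrite leeD2r// lee_wpmul2l// lee_fin.
rewrite -!(EFinM, EFinD) lee_fin exprS.
rewrite le_eqVlt; apply/orP; left; apply/eqP.
by field; rewrite !gt_eqF.
Qed.
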